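(* Fix an integer $d\ge 2$. Let $n=(d+1)^m$ where $m\in\mathbb{N}$ is sufficiently large. Then there is a $d$-tournament $T_d$ on $n$ vertices with at least $$\frac{1}{1+\binom{d+1}{2}}\binom{n}{d+1}-o(n^{d+1})$$ directed $d$-simplices, where the $o(n^{d+1})$ term is as $m\to\infty$ with $d$ fixed. In particular, $c_d \geq \frac{1}{1+\binom{d+1}{2}}$.
   Context: Orientations of finite sets are defined inductively. An orientation of a 1-set $\{x\}$ is an assignment of $+1$ or $-1$ to $x$. An orientation of a 2-set $\{a,b\}$ is a directed edge from $a$ to $b$ or from $b$ to $a$; a directed edge from $a$ to $b$ is regarded as assigning $+1$ to $b$ and $-1$ to $a$. For $d\ge 3$, an orientation of a $d$-set consists of an orientation of each of its $(d-1)$-subsets such that these are pairwise compatible. Here, for $k\ge 2$, two oriented $k$-sets sharing a common $(k-1)$-subset are compatible if they give different orientations to that common $(k-1)$-subset. For $d\ge 2$, a $d$-tournament (tournament of order $d$) on $n$ vertices is a set of $n$ vertices together with an orientation of each of its $d$-subsets. A $d$-simplex in a $d$-tournament is a $(d+1)$-subset of the vertex set; it is directed if its $d+1$ oriented $d$-subsets are pairwise compatible. The constant $c_d$ is defined as $\lim_{n\to\infty} M_d(n)/\binom{n}{d+1}$, where $M_d(n)$ is the greatest number of directed $d$-simplices in a $d$-tournament on $n$ vertices (the limit exists by an averaging argument). *)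

(* Defs.v *)
From HB Require Import structures.
From mathcomp Require Import all_boot all_order all_algebra.
From mathcomp Require Import all_classical all_reals all_analysis.
Set Implicit Arguments.
Unset Strict Implicit.
Unset Printing Implicit Defensive.
Import Order.TTheory GRing.Theory Num.Theory.
Import numFieldNormedType.Exports.

(* Values of type [orient_data T k] encode orientations of sets with k.+1
   elements. For a singleton it is a sign, [true] standing for +1 and [false]
   for -1. For a larger set it is a partial function that gives an orientation
   to each subset with one element fewer and is [None] elsewhere, so that equal
   orientations are equal in the sense of Leibniz. *)
Fixpoint orient_data (T : finType) (k : nat) : finType :=
  if k is k'.+1 then {ffun {set T} -> option (orient_data T k')} else bool.

Definition family (T : finType) (k : nat) : finType :=
  {ffun {set T} -> option (orient_data T k)}.

(* Compatibility of an orientation o of A with an orientation p of B, for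
   distinct A and B with k.+1 elements; when they share a subset with k elements
   it is A :&: B. Case k = 0 only serves to define orientations of pairs: a
   directed edge from a to b is the assignment of -1 to [set a] and +1 to
   [set b], so the two singletons must have distinct signs. *)
Definition compatible (T : finType) (k : nat) (A B : {set T}) :
    orient_data T k -> orient_data T k -> bool :=
  match k with
  | 0 => fun o p => o != p
  | k'.+1 => fun o p : family T k' => o (A :&: B) != p (A :&: B)
  end.

Definition pairwise_compatible (T : finType) (k : nat) (f : family T k)
    (S : {set T}) : bool :=
  [forall A : {set T}, forall B : {set T},
    [&& A \subset S, B \subset S, #|A| == k.+1, #|B| == k.+1 & A != B] ==>
    match f A, f B with
    | Some o, Some p => compatible A B o p
    | _, _ => false
    end].

Fixpoint is_orientation (T : finType) (k : nat) (A : {set T}) :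
    orient_data T k -> bool :=
  match k with
  | 0 => fun _ => #|A| == 1
  | k'.+1 => fun o : family T k' =>
      [&& #|A| == k'.+2,
          [forall B : {set T},
            if o B is Some p then (B \subset A) && is_orientation B p
            else ~~ ((B \subset A) && (#|B| == k'.+1))]
        & pairwise_compatible o A]
  end.

(* For d >= 1, exactly the sets with d elements are oriented; the predecessor
   is the index shift in [orient_data]. *)
Definition is_tournament (d : nat) (T : finType) (t : family T d.-1) : bool :=
  [forall A : {set T},
    if t A is Some o then is_orientation A o else #|A| != d].

Definition tournament (d : nat) (T : finType) : finType :=
  {t : family T d.-1 | is_tournament t}.

Definition directed_simplices (d : nat) (T : finType) (t : tournament d T) :
    {set {set T}} :=
  [set S : {set T} | (#|S| == d.+1) && pairwise_compatible (val t) S].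

Definition max_directed (d n : nat) : nat :=
  \max_(t : tournament d 'I_n) #|directed_simplices t|.

Local Open Scope ring_scope.

Definition directed_ratio (R : realType) (d n : nat) : R :=
  (max_directed d n)%:R / 'C(n, d.+1)%:R.

Definition c_ (R : realType) (d : nat) : R :=
  limn (fun n => directed_ratio R d n).

(* Main.v *)
Require Import Defs.
From HB Require Import structures.
From mathcomp Require Import all_boot all_order all_algebra.
From mathcomp Require Import all_classical all_reals all_analysis.
Set Implicit Arguments.
Unset Strict Implicit.
Unset Printing Implicit Defensive.
Import Order.TTheory GRing.Theory Num.Theory.
Import numFieldNormedType.Exports.

Local Notation family := Defs.family.

(** Let q = d + 1. The vertices are the words of length m over an alphabet of
    q colours, so that d + 1 vertices form a matrix with d + 1 rows and m
    columns, each column being a map from the rows to the colours. Fix a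
    directed simplex on the colours, that is, the boundary of an oriented
    simplex with q vertices. A d-set of vertices is oriented by its first column
    that is injective: it is identified by that column with a face of the
    colour simplex, whose orientation is pulled back.

    Given d + 1 vertices, consider the first column that is injective on some
    d of them. If that column is a bijection onto the colours, then it is the
    first injective column of each of the d-subsets, hence all of them are
    oriented as in the colour simplex and the d + 1 vertices are directed
    ([first_rainbow_directed]). Among all maps from the rows to the colours, q!
    are bijective, and at most 'C(q, 2) * q! others are injective on d rows,
    since such a map is given by the two rows that it identifies and by an
    injection on d rows ([card_near_rainbow]). So the column in question is
    bijective with probability at least 1 / (1 + 'C(q, 2)), and it fails to
    exist only with probability rho ^ m, where rho < 1
    ([count_first_bijective]).

    Deleting each vertex in turn shows that the greatest proportion of directed
    simplices is nonincreasing in the number n of vertices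
    ([max_directed_averaging], [directed_ratio_nonincreasing]). It therefore
    converges, and as it is at least (1 - rho ^ m) / (1 + 'C(q, 2)) at q ^ m
    for every m, it is at least 1 / (1 + 'C(q, 2)) for every n > d
    ([directed_ratio_ge]). Hence optimal tournaments satisfy the lower bound
    with error term 0. *)

(** * Orientations and compatibility *)

Lemma pairwise_compatibleP (T : finType) (k : nat) (f : family T k)
    (S : {set T}) :
  reflect (forall A B : {set T}, A \subset S -> B \subset S ->
             #|A| = k.+1 -> #|B| = k.+1 -> A != B ->
             exists o p, [/\ f A = Some o, f B = Some p & compatible A B o p])
          (pairwise_compatible f S).
Proof.
apply: (iffP forallP) => [H A B sA sB cA cB neAB | H A].
  move: (H A) => /forallP/(_ B).
  rewrite sA sB cA cB neAB !eqxx /=.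
  by case: (f A) => // o; case: (f B) => // p ?; exists o, p.
apply/forallP=> B; apply/implyP=> /and5P[sA sB /eqP cA /eqP cB neAB].
by have [a [b [-> ->]]] := H A B sA sB cA cB neAB.
Qed.

Lemma eq_pairwise_compatible (T : finType) (k : nat) (f g : family T k)
    (S : {set T}) :
  (forall A : {set T}, A \subset S -> #|A| = k.+1 -> f A = g A) ->
  pairwise_compatible f S -> pairwise_compatible g S.
Proof.
move=> eq_fg /pairwise_compatibleP H; apply/pairwise_compatibleP.
move=> A B sA sB cA cB neAB; rewrite -!eq_fg //; exact: H.
Qed.

Lemma is_orientation_some (T : finType) (k : nat) (A B : {set T})
    (o : orient_data T k.+1) (p : orient_data T k) :
  is_orientation A o -> (o : family T k) B = Some p ->
  B \subset A /\ is_orientation B p.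
Proof. by case/and3P=> _ /forallP/(_ B) + _ => /[swap] -> /andP. Qed.

Lemma is_orientation_face (T : finType) (k : nat) (A B : {set T})
    (o : orient_data T k.+1) :
  is_orientation A o -> B \subset A -> #|B| = k.+1 ->
  exists p, (o : family T k) B = Some p.
Proof.
case/and3P=> _ /forallP/(_ B) + _ => /[swap] -> /[swap] ->.
by rewrite eqxx; case: ((o : family T k) B) => // p _; exists p.
Qed.

Lemma is_orientation_card (T : finType) (k : nat) (A : {set T})
    (o : orient_data T k) :
  is_orientation A o -> #|A| = k.+1.
Proof. by case: k o => [|k] o /=; [move/eqP | case/and3P=> /eqP]. Qed.

(** * Pulling orientations back along a map *)

(** Only the images of subsets of [A] are looked up, because [chi] is used for
    columns, which are injective on the set at hand but not on all vertices. *)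
Fixpoint pull (U T : finType) (chi : U -> T) (k : nat) (A : {set U}) :
    orient_data T k -> orient_data U k :=
  match k with
  | 0 => id
  | k'.+1 => fun o : family T k' =>
      [ffun B : {set U} =>
         if B \subset A then omap (@pull U T chi k' B) (o (chi @: B)) else None]
  end.

Lemma sub_imset_preim (U T : finType) (chi : U -> T) (A : {set U})
    (B : {set T}) :
  B \subset chi @: A -> exists2 C : {set U}, C \subset A & B = chi @: C.
Proof.
move=> sBA; exists (A :&: chi @^-1: B); first exact: subsetIl.
apply/setP=> y; apply/idP/imsetP => [yB | [x]].
  have /imsetP[x xA def_y] := fintype.subsetP sBA y yB.
  by exists x => //; rewrite !inE xA -def_y.
by rewrite !inE => /andP[_ + ->].
Qed.

Lemma inj_on_sub (U T : finType) (chi : U -> T) (A B : {set U}) :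
  A \subset B -> {in B &, injective chi} -> {in A &, injective chi}.
Proof. by move=> /fintype.subsetP s; apply: sub_in2. Qed.

(** Since compatibility is a disagreement on a common face, it survives a pull
    back exactly when distinct orientations stay distinct. *)
Lemma pull_inj (U T : finType) (chi : U -> T) (k : nat) (A : {set U})
    (o p : orient_data T k) :
  is_orientation (chi @: A) o -> is_orientation (chi @: A) p ->
  pull chi A o = pull chi A p -> o = p.
Proof.
elim: k A o p => [//|k IHk] A o p oA pA eq_op.
apply/ffunP=> B; case: (boolP (B \subset chi @: A)) => [sBA | nsBA].
  have [C sCA defB] := sub_imset_preim sBA.
  have := congr1 (fun f : family U k => f C) eq_op; rewrite !ffunE sCA -defB.
  case Eo: (o B) => [a|]; case Ep: (p B) => [p'|] //= [eq_op'].
  have [_ oB] := is_orientation_some oA Eo.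
  have [_ pB] := is_orientation_some pA Ep.
  by congr Some; apply: (IHk C); rewrite -?defB.
case Eo: (o B) => [a|].
  by have [sBA _] := is_orientation_some oA Eo; rewrite sBA in nsBA.
case Ep: (p B) => [p'|] //.
by have [sBA _] := is_orientation_some pA Ep; rewrite sBA in nsBA.
Qed.

Lemma pull_compatible (U T : finType) (chi : U -> T) (k : nat)
    (A B : {set U}) (o p : orient_data T k) :
  {in A :|: B &, injective chi} ->
  is_orientation (chi @: A) o -> is_orientation (chi @: B) p ->
  compatible (chi @: A) (chi @: B) o p ->
  compatible A B (pull chi A o) (pull chi B p).
Proof.
case: k o p => [//|k] o p injAB oA pB /=.
have defI : chi @: A :&: chi @: B = chi @: (A :&: B).
  apply/esym/imsetI => x y xA yB; apply: injAB; rewrite inE ?xA ?yB ?orbT //.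
rewrite defI !ffunE subsetIl subsetIr.
apply: contra => /eqP eq_op; apply/eqP; move: eq_op.
case Eo: (o _) => [a|]; case Ep: (p _) => [p'|] //= [eq_op].
have [_ oI] := is_orientation_some oA Eo.
have [_ pI] := is_orientation_some pB Ep.
by congr Some; apply: pull_inj eq_op.
Qed.

(** The same statement serves three purposes: with [f] an orientation it is the
    compatibility clause of [is_orientation_pull], with [f] the colour simplex
    it makes rainbow sets directed, and with [f] a tournament it transports
    directed simplices to a subtournament. *)
Lemma pull_pairwise_compatible (U T : finType) (chi : U -> T) (k : nat)
    (S : {set U}) (f : family T k) (g : family U k) :
  {in S &, injective chi} ->
  (forall (B : {set T}) o, f B = Some o -> is_orientation B o) ->
  (forall A : {set U}, A \subset S -> g A = omap (pull chi A) (f (chi @: A))) ->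
  pairwise_compatible f (chi @: S) -> pairwise_compatible g S.
Proof.
move=> injS orf defg /pairwise_compatibleP compf.
apply/pairwise_compatibleP => A B sA sB cA cB neAB.
have [||||| q [p [Eo Ep comp]]] := compf (chi @: A) (chi @: B).
- exact: imsetS.
- exact: imsetS.
- by rewrite card_in_imset //; apply: inj_on_sub injS.
- by rewrite card_in_imset //; apply: inj_on_sub injS.
- apply: contra neAB => /eqP eqAB.
  rewrite eqEcard cA cB leqnn andbT; apply/fintype.subsetP => x xA.
  have /imsetP[y yB /injS->] : chi x \in chi @: B by rewrite -eqAB imset_f.
  + by [].
  + exact: (fintype.subsetP sA).
  + exact: (fintype.subsetP sB).
exists (pull chi A q), (pull chi B p); split.
- by rewrite defg // Eo.
- by rewrite defg // Ep.
- apply: pull_compatible comp; last 2 first.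
  + exact: orf.
  + exact: orf.
  + by apply: inj_on_sub injS; rewrite finset.subUset sA.
Qed.

Lemma is_orientation_pull (U T : finType) (chi : U -> T) (k : nat)
    (A : {set U}) (o : orient_data T k) :
  {in A &, injective chi} ->
  is_orientation (chi @: A) o -> is_orientation A (pull chi A o).
Proof.
elim: k A o => [|k IHk] A o injA oA.
  by have /= := oA; rewrite card_in_imset.
apply/and3P; split.
- by rewrite -(card_in_imset injA) (is_orientation_card oA).
- apply/forallP=> B; rewrite ffunE.
  case: ifPn => // sBA; have injB := inj_on_sub sBA injA.
  case Eo: (o _) => [p|] /=.
    by apply: IHk => //; have [] := is_orientation_some oA Eo.
  apply/negP=> /= /eqP cB.
  have [||p] := is_orientation_face (B := chi @: B) oA.
  + exact: imsetS.
  + by rewrite card_in_imset.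
  by rewrite Eo.
- apply: (pull_pairwise_compatible injA (f := o)).
  + by move=> B p /(is_orientation_some oA)[].
  + by move=> B sBA; rewrite ffunE sBA.
  + by case/and3P: oA.
Qed.

(** * The standard orientations of a set *)

Definition rank_in (T : finType) (A : {set T}) (x : T) : nat :=
  #|[set y in A | (enum_rank y < enum_rank x)%N]|.

(** The usual signed boundary: the face missing [x] carries the sign
    (-1) ^ rank of [x], multiplied by the global sign [b]. *)
Fixpoint std_orientation (T : finType) (k : nat) (A : {set T}) (b : bool) :
    orient_data T k :=
  match k with
  | 0 => b
  | k'.+1 =>
      [ffun B : {set T} =>
         omap (fun x => std_orientation k' B (b (+) odd (rank_in A x)))
           [pick x in A | B == A :\ x]]
  end.

Lemma std_orientation_face (T : finType) (k : nat) (A : {set T}) (b : bool)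
    (x : T) :
  x \in A ->
  (std_orientation k.+1 A b : family T k) (A :\ x) =
    Some (std_orientation k (A :\ x) (b (+) odd (rank_in A x))).
Proof.
move=> xA; rewrite ffunE.
case: pickP => [y /andP[yA /eqP eqA]|/(_ x)] /=; last first.
  by rewrite xA eqxx.
congr (Some (std_orientation _ _ (_ (+) odd (rank_in _ _)))).
apply/eqP; have := setD11 x A.
by rewrite eqA !inE xA andbT => /negbFE; rewrite eq_sym.
Qed.

Lemma std_orientation_neg (T : finType) (k : nat) (A : {set T}) (b c : bool) :
  #|A| = k.+1 -> std_orientation k A b = std_orientation k A c -> b = c.
Proof.
elim: k A b c => [//|k IHk] A b c cA eq_bc.
have /card_gt0P[x xA] : (0 < #|A|)%N by rewrite cA.
have := congr1 (fun f : family T k => f (A :\ x)) eq_bc.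
rewrite !std_orientation_face // => -[/IHk].
have cAx : #|A :\ x| = k.+1 by move: cA; rewrite (cardsD1 x) xA => -[].
by move/(_ cAx); apply: addIb.
Qed.

Lemma card_pred_subset (T : finType) (k : nat) (A B : {set T}) :
  B \subset A -> #|A| = k.+1 -> #|B| = k -> exists2 x, x \in A & B = A :\ x.
Proof.
move=> sBA cA cB.
have /eqP/cards1P[x defx] : #|A :\: B| = 1.
  by rewrite cardsD (finset.setIidPr sBA) cA cB subSnn.
exists x.
  by have: x \in A :\: B by [rewrite defx finset.set11]; case/finset.setDP.
rewrite -defx finset.setDDr finset.setDv finset.set0U.
exact/esym/finset.setIidPr.
Qed.

(** The boundary of a boundary vanishes: the two ways of removing [x] and [y]
    have opposite signs, because removing one of them lowers the rank of
    the other for exactly one of the two choices. *)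
Lemma rank_in_swap (T : finType) (A : {set T}) (x y : T) :
  x \in A -> y \in A -> x != y ->
  odd (rank_in A x) (+) odd (rank_in (A :\ x) y) !=
  odd (rank_in A y) (+) odd (rank_in (A :\ y) x).
Proof.
have rankD u v : u \in A ->
    rank_in A v = ((enum_rank u < enum_rank v) + rank_in (A :\ u) v)%N.
  move=> uA; rewrite /rank_in (cardsD1 u) inE uA /=.
  congr (_ + #|pred_of_set _|)%N.
  by apply/setP=> w; rewrite !inE andbA.
move=> xA yA neq_xy; rewrite (rankD y x yA) (rankD x y xA) !oddD.
have: (enum_rank x < enum_rank y)%N = ~~ (enum_rank y < enum_rank x)%N.
  rewrite -leqNgt ltn_neqAle; case: eqP => //= eq_xy.
  by rewrite (enum_rank_inj (val_inj eq_xy)) eqxx in neq_xy.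
by move->; do 2 case: (odd (rank_in _ _)); case: (_ < _)%N.
Qed.

Lemma is_orientation_std (T : finType) (k : nat) (A : {set T}) (b : bool) :
  #|A| = k.+1 -> is_orientation A (std_orientation k A b).
Proof.
elim: k A b => [|k IHk] A b cA; first exact/eqP.
have cAx x : x \in A -> #|A :\ x| = k.+1.
  by move=> xA; move: cA; rewrite (cardsD1 x) xA => -[].
apply/and3P; split; first exact/eqP.
  apply/forallP=> B; case: (boolP ((B \subset A) && (#|B| == k.+1))).
    case/andP=> sBA /eqP cB; have [x xA ->] := card_pred_subset sBA cA cB.
    by rewrite std_orientation_face // subD1set; apply: IHk; apply: cAx.
  move=> nB; rewrite ffunE; case: pickP => [x /andP[xA /eqP defB]|] //.
  by rewrite defB subD1set cAx ?eqxx in nB.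
apply/pairwise_compatibleP=> B C sB sC cB cC neBC.
have [x xA defB] := card_pred_subset sB cA cB.
have [y yA defC] := card_pred_subset sC cA cC.
have neq_xy : x != y.
  by apply: contra neBC => /eqP eq_xy; rewrite defB defC eq_xy.
rewrite {}defB {}defC; rewrite !std_orientation_face //.
do 2 eexists; split=> //; move: (rank_in_swap xA yA neq_xy).
case: k IHk cA cAx cB cC => [|k] IHk cA cAx cB cC /= neq_rk.
  (* For a pair, the faces are single points, which share no face: the signs
     themselves differ, as the ranks left after removing a point are 0. *)
  have rank0 u v : u \in A -> v \in A -> u != v -> rank_in (A :\ u) v = 0.
    move=> uA vA neq_uv; apply/eqP; rewrite cards_eq0 -finset.subset0.
    have /eqP/cards1P[w defw] := cAx u uA.
    have: v \in A :\ u by rewrite !inE eq_sym neq_uv.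
    rewrite defw => /set1P->; apply/fintype.subsetP=> z.
    by rewrite !inE => /andP[/eqP->]; rewrite ltnn.
  move: neq_rk; rewrite !rank0 // 1?eq_sym // !addbF.
  by apply: contra => /eqP/addbI->.
have yAx : y \in A :\ x by rewrite !inE eq_sym neq_xy.
have xAy : x \in A :\ y by rewrite !inE neq_xy.
have faceI u v a : v \in A :\ u ->
    (std_orientation k.+1 (A :\ u) a : family T k) ((A :\ u) :&: (A :\ v)) =
    Some (std_orientation k (A :\ u :\ v) (a (+) odd (rank_in (A :\ u) v))).
  move=> vAu; have -> : (A :\ u) :&: (A :\ v) = A :\ u :\ v.
    apply/setP=> z; rewrite !inE.
    by case: (z == u); case: (z == v); case: (z \in A).
  exact: std_orientation_face.
have swapD : A :\ y :\ x = A :\ x :\ y by rewrite !finset.setDDl finset.setUC.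
have faceI' := faceI y x (b (+) odd (rank_in A y)) xAy.
rewrite finset.setIC swapD in faceI'.
rewrite (faceI x y _ yAx) faceI'.
apply: contra neq_rk => /eqP-[/std_orientation_neg].
rewrite -!addbA => eqb; apply/eqP/(@addbI b)/eqb.
by move: (cAx x xA); rewrite (cardsD1 y) yAx => -[].
Qed.

(** * The tournament of first rainbow columns *)

Lemma is_tournamentP (T : finType) (k : nat) (t : family T k) :
  reflect ((forall (A : {set T}) o, t A = Some o -> is_orientation A o) /\
           (forall A : {set T}, #|A| = k.+1 -> t A))
          (is_tournament (d := k.+1) t).
Proof.
apply: (iffP forallP) => [H | [H1 H2] A].
  split=> A; first by move=> o tA; have := H A; rewrite tA.
  by move=> cA; have := H A; case: (t A) => //; rewrite cA eqxx.
case tA: (t A) => [a|]; first exact: H1.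
by apply/eqP=> /H2; rewrite tA.
Qed.

(** An orientation of the (k + 2)-set of colours is also the family of the
    orientations that it induces on the (k + 1)-sets of colours, which is a
    directed simplex. *)
Definition simplex_boundary (k : nat) : family 'I_k.+2 k :=
  std_orientation k.+1 [set: 'I_k.+2] true.

Lemma simplex_boundary_orientation (k : nat) :
  is_orientation (k := k.+1) [set: 'I_k.+2] (simplex_boundary k).
Proof. by apply: is_orientation_std; rewrite cardsT card_ord. Qed.

(** Sets of the wrong size need no separate test in the first branch:
    [simplex_boundary] is [None] on the image of such a set. A set on which no
    column is injective gets an arbitrary orientation. *)
Fixpoint rainbow (T : finType) (k : nat) (cs : seq (T -> 'I_k.+2)) :
    family T k :=
  if cs is c :: cs' then
    [ffun A : {set T} =>
       if dinjectiveb c (mem A)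
       then omap (pull c A) (simplex_boundary k (c @: A)) else rainbow cs' A]
  else
    [ffun A : {set T} =>
       if #|A| == k.+1 then Some (std_orientation k A true) else None].

Lemma rainbow_tournament (T : finType) (k : nat) (cs : seq (T -> 'I_k.+2)) :
  is_tournament (d := k.+1) (rainbow cs).
Proof.
have orb := simplex_boundary_orientation k.
apply/is_tournamentP; elim: cs => [|c cs [IH1 IH2]] /=.
  split=> A; rewrite ffunE; last by move=> cA; rewrite cA eqxx.
  by move=> o; case: ifP => // /eqP cA [<-]; apply: is_orientation_std.
split=> A; rewrite ffunE.
  move=> o; case: ifPn => [/dinjectiveP injA | _]; last exact: IH1.
  case E: (simplex_boundary k _) => [p|] //= [<-].
  by apply: is_orientation_pull => //; have [] := is_orientation_some orb E.
move=> cA; case: ifPn => [/dinjectiveP injA | _]; last exact: IH2.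
have [||p ->] := is_orientation_face (B := c @: A) orb; last by [].
  exact: finset.subsetT.
by rewrite card_in_imset.
Qed.

Fixpoint first_rainbow (T : finType) (k : nat) (cs : seq (T -> 'I_k.+2))
    (S : {set T}) : bool :=
  if cs is c :: cs' then
    dinjectiveb c (mem S) ||
    [forall x in S, ~~ dinjectiveb c (mem (S :\ x))] && first_rainbow cs' S
  else false.

(** A column that is injective on [S] is injective on each of its faces, so it
    decides their orientations; a column that is injective on none of the faces
    decides nothing and can be dropped. *)
Lemma first_rainbow_directed (T : finType) (k : nat) (cs : seq (T -> 'I_k.+2))
    (S : {set T}) :
  #|S| = k.+2 -> first_rainbow cs S -> pairwise_compatible (rainbow cs) S.
Proof.
move=> cS; elim: cs => [//|c cs IHcs] /= /orP[/dinjectiveP injS | ].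
  have orb := simplex_boundary_orientation k.
  apply: (pull_pairwise_compatible injS (f := simplex_boundary k)).
  - by move=> B o /(is_orientation_some orb)[].
  - move=> A sAS; rewrite ffunE ifT //.
    by apply/dinjectiveP; apply: inj_on_sub injS.
  - have -> : c @: S = [set: 'I_k.+2].
      apply/eqP; rewrite eqEcard finset.subsetT cardsT card_ord.
      by rewrite card_in_imset // cS /=.
    by case/and3P: orb.
case/andP=> /forall_inP ninj /IHcs; apply: eq_pairwise_compatible => A sA cA.
have [x xS ->] := card_pred_subset sA cS cA.
by rewrite [RHS]ffunE ifN // ninj.
Qed.

(** * Counting matrices by their columns *)

(** A column seen as a map from the rows to the colours. The columns for which
    this fails leave the orientations of all faces undecided. *)
Definition near_rainbow (k : nat) (q : {ffun 'I_k.+2 -> 'I_k.+2}) : bool :=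
  [exists j, dinjectiveb q (mem [set~ j])].

Fixpoint first_bijective (k : nat) (qs : seq {ffun 'I_k.+2 -> 'I_k.+2}) :
    bool :=
  if qs is q :: qs' then
    injectiveb q || ~~ near_rainbow q && first_bijective qs'
  else false.

Lemma first_bijective_rainbow (T : finType) (k : nat)
    (cs : seq (T -> 'I_k.+2)) (r : {ffun 'I_k.+2 -> T}) :
  injective r ->
  first_bijective [seq [ffun i => c (r i)] | c : T -> 'I_k.+2 <- cs] ->
  first_rainbow cs (r @: [set: 'I_k.+2]).
Proof.
move=> injr; elim: cs => [//|c cs IHcs] /= /orP[/injectiveP injc | ].
  apply/orP; left; apply/dinjectiveP=> _ _ /imsetP[i _ ->] /imsetP[j _ ->] eqc.
  by congr (r _); apply: injc; rewrite !ffunE.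
case/andP=> /existsPn nnear /IHcs ->; rewrite andbT; apply/orP; right.
apply/forall_inP=> _ /imsetP[j _ ->]; apply: contra (nnear j).
move=> /dinjectiveP inj; apply/dinjectiveP=> i i'.
rewrite !inE !ffunE => ni ni' eqc.
by apply/injr/inj => //; rewrite !inE (inj_eq injr) ?ni ?ni' imset_f.
Qed.

(** The counted matrices automatically have distinct rows, because they have a
    bijective column. *)
Lemma first_bijective_distinct (k : nat)
    (qs : seq {ffun 'I_k.+2 -> 'I_k.+2}) (i j : 'I_k.+2) :
  first_bijective qs ->
  {in qs, forall q : {ffun 'I_k.+2 -> 'I_k.+2}, q i = q j} -> i = j.
Proof.
elim: qs => [//|q qs IHqs] /= /orP[/injectiveP injq | /andP[_ /IHqs IH]] eqs.
  by apply: injq; apply: eqs; rewrite mem_head.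
by apply: IH => p pqs; apply: eqs; rewrite inE pqs orbT.
Qed.

Lemma leq_card_bigcup (T I : finType) (Q : pred I) (F : I -> {set T})
    (u : I -> nat) :
  (forall i, Q i -> #|F i| <= u i) ->
  #|\bigcup_(i | Q i) F i| <= \sum_(i | Q i) u i.
Proof.
move=> leF; elim/big_ind2: _ => [|A a B b leA leB|i /leF //].
  by rewrite finset.cards0.
by apply: leq_trans (leq_card_setU _ _) (leq_add leA leB).
Qed.

Lemma card_bijective (k : nat) :
  #|[set q : {ffun 'I_k -> 'I_k} | injectiveb q]| = k`!.
Proof. by rewrite card_inj_ffuns !card_ord ffactnn. Qed.

(** Such a map is determined by its restriction to the rows other than [j],
    which is injective. *)
Lemma card_near_pair (k : nat) (i j : 'I_k.+2) : i != j ->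
  #|[set q : {ffun 'I_k.+2 -> 'I_k.+2} |
      (q i == q j) && dinjectiveb q (mem [set~ j])]| <= k.+2`!.
Proof.
move=> neq_ij.
pose del (q : {ffun 'I_k.+2 -> 'I_k.+2}) := [ffun x : 'I_k.+1 => q (lift j x)].
rewrite -(@card_in_imset _ _ del).
  have <- : k.+2 ^_ k.+1 = k.+2`!.
    by rewrite -[RHS]ffactnn [RHS]ffactnSr subSnn muln1.
  have <- : #|[set f : {ffun 'I_k.+1 -> 'I_k.+2} | injectiveb f]| =
            k.+2 ^_ k.+1.
    by rewrite card_inj_ffuns !card_ord.
  apply/subset_leq_card/fintype.subsetP=> f /imsetP[q + ->].
  rewrite !inE => /andP[_ /dinjectiveP injq].
  apply/injectiveP=> x y; rewrite !ffunE => /injq eq_xy; apply: (@lift_inj _ j).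
  by apply: eq_xy; rewrite !inE eq_sym neq_lift.
move=> q q'; rewrite !inE => /andP[/eqP qi _] /andP[/eqP q'i _] eq_del.
have eqq x : x != j -> q x = q' x.
  rewrite eq_sym => /unlift_some[y -> _].
  have := congr1 (fun f : {ffun 'I_k.+1 -> 'I_k.+2} => f y) eq_del.
  by rewrite !ffunE.
apply/ffunP=> x; have [->|/eqq//] := eqVneq x j.
by rewrite -qi -q'i eqq.
Qed.

(** If [q] is injective off row [j] but not injective, then it sends [j] and
    some other row [i] to the same colour, and it is injective off [i] as well;
    so the two rows can be named in increasing order. *)
Lemma card_near_rainbow (k : nat) :
  #|[set q | @near_rainbow k q]| <= (1 + 'C(k.+2, 2)) * k.+2`!.
Proof.
pose P (i j : 'I_k.+2) := [set q : {ffun 'I_k.+2 -> 'I_k.+2} |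
      (q i == q j) && dinjectiveb q (mem [set~ j])].
have sub : [set q | @near_rainbow k q] \subset
    [set q : {ffun 'I_k.+2 -> 'I_k.+2} | injectiveb q] :|:
    \bigcup_(j : 'I_k.+2) \bigcup_(i : 'I_k.+2 | i < j) P i j.
  apply/fintype.subsetP=> q; rewrite !inE => /existsP[j /dinjectiveP injj].
  case: (boolP (injectiveb q)) => //= /injectivePn[x [y neq_xy eq_q]].
  have {x y neq_xy eq_q} [i neq_ij eq_q] : exists2 i, i != j & q i = q j.
    have [eq_yj|neq_yj] := eqVneq y j; first by exists x; rewrite -?eq_yj.
    have [eq_xj|neq_xj] := eqVneq x j; first by exists y => //; rewrite -eq_xj.
    by move: neq_xy; rewrite (injj x y) ?eqxx // !inE.
  have [lt_ij|lt_ji|eq_ij] := ltngtP i j.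
  - apply/bigcupP; exists j => //; apply/bigcupP; exists i => //.
    by rewrite inE eq_q eqxx; apply/dinjectiveP.
  - apply/bigcupP; exists i => //; apply/bigcupP; exists j => //.
    rewrite inE eq_q eqxx; apply/dinjectiveP=> x y.
    rewrite !inE => nxi nyi eq_xy.
    have [eqx|nx] := eqVneq x j; have [eqy|ny] := eqVneq y j.
    + by rewrite eqx eqy.
    + by move: nyi; rewrite (injj i y) ?eqxx // ?inE ?ny // eq_q -eqx.
    + by move: nxi; rewrite (injj i x) ?eqxx // ?inE ?nx // eq_q -eqy.
    + by apply: injj; rewrite ?inE.
  - by rewrite (val_inj eq_ij) eqxx in neq_ij.
apply: leq_trans (subset_leq_card sub) _.
apply: leq_trans (leq_card_setU _ _) _.
rewrite card_bijective mulnDl mul1n leq_add2l.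
have -> : 'C(k.+2, 2) = \sum_(j < k.+2) \sum_(i < k.+2 | i < j) 1.
  rewrite -bin2_sum big_mkord; apply: eq_bigr => j _.
  rewrite -(big_ord_widen k.+2 (fun=> 1%N)) ?sum1_card ?card_ord //.
  exact: ltnW.
rewrite big_distrl; apply: leq_card_bigcup => j _.
rewrite big_distrl; apply: leq_card_bigcup => i lt_ij.
by rewrite /= mul1n; apply: card_near_pair; rewrite -val_eqE ltn_eqF.
Qed.

(** With N columns, c of them near rainbow and F of them bijective, the numbers
    g m of the matrices with m columns satisfy
    g (m + 1) = F * N ^ m + (N - c) * g m, according to whether the first column
    is bijective, near rainbow but not bijective, or not near rainbow. The
    lemma is the solution g m = (F / c) * (N ^ m - (N - c) ^ m) without
    division. *)
Lemma count_first_bijective (k m : nat) :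
  let N := #|{: {ffun 'I_k.+2 -> 'I_k.+2}}| in
  let c := #|[set q | @near_rainbow k q]| in
  c * #|[set qs : m.-tuple {ffun 'I_k.+2 -> 'I_k.+2} | first_bijective qs]|
    + k.+2`! * (N - c) ^ m = k.+2`! * N ^ m.
Proof.
move=> N c.
pose g l :=
  #|[set qs : l.-tuple {ffun 'I_k.+2 -> 'I_k.+2} | first_bijective qs]|.
rewrite -/(g m); elim: m => [|m IHm].
  rewrite !expn0 /g eq_card0 ?muln0 // => qs; rewrite inE.
  by rewrite [qs]tuple0.
have leN : c <= N by rewrite /N -cardsT; apply/subset_leq_card/finset.subsetT.
have -> : g m.+1 = (k.+2`! * N ^ m + (N - c) * g m)%N.
  pose G q : nat := \sum_(qs : m.-tuple {ffun 'I_k.+2 -> 'I_k.+2})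
    first_bijective (q :: qs).
  have -> : g m.+1 = \sum_q G q.
    rewrite /g -sum1dep_card big_mkcond /=.
    rewrite pair_big /=.
    rewrite (reindex (fun p : _ * m.-tuple _ => cons_tuple p.1 p.2)) /=.
      by apply: eq_bigr => p _; case: ifP.
    exists (fun t : m.+1.-tuple _ => (thead t, behead_tuple t)) => [[q qs]|t] _.
      by congr pair; apply: val_inj.
    by case/tupleP: t => q qs; apply: val_inj.
  rewrite (bigID (@near_rainbow k)) /=; congr addn.
    rewrite (bigID (fun q : {ffun 'I_k.+2 -> 'I_k.+2} => injectiveb q)) /=.
    rewrite [X in (_ + X)%N]big1 ?addn0; last first.
      move=> q /andP[nq iq]; apply: big1 => qs _ /=.
      by rewrite (negPf iq) nq.
    rewrite (eq_bigr (fun=> N ^ m)%N) ?sum_nat_cond_const; last first.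
      by move=> q /andP[_ iq]; rewrite /G /= iq sum1_card card_tuple.
    congr (_ * _)%N; rewrite -card_bijective; apply: eq_card => q.
    rewrite !inE; apply: andb_idl => /injectiveP iq.
    by apply/existsP; exists ord0; apply/dinjectiveP=> x y _ _ /iq.
  rewrite (eq_bigr (fun=> g m)) ?sum_nat_cond_const; last first.
    move=> q nq; have niq : ~~ injectiveb q.
      apply: contra nq => /injectiveP iq.
      by apply/existsP; exists ord0; apply/dinjectiveP=> x y _ _ /iq.
    rewrite /g -sum1dep_card big_mkcond /G /= (negPf niq) nq /=.
    by apply: eq_bigr => qs _; case: ifP.
  congr (_ * _)%N; rewrite /N -(cardsC [set q | near_rainbow q]) addKn.
  by apply: eq_card => q; rewrite !inE.
rewrite mulnDr mulnCA (mulnCA c (N - c)%N) -addnA expnS.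
rewrite (mulnCA _ (N - c)%N) -mulnDr IHm.
by rewrite expnS !(mulnCA _ k.+2`!) -mulnDr -mulnDl subnKC.
Qed.

(** * From matrices to vertex sets *)

(** Each set of size [p] has p! injective enumerations. *)
Lemma card_inj_ffuns_image (T : finType) (p : nat) (D : {set {set T}}) :
  {in D, forall S : {set T}, #|S| = p} ->
  #|[set r : {ffun 'I_p -> T} | injectiveb r && (r @: [set: 'I_p] \in D)]|
    <= #|D| * p`!.
Proof.
move=> cD; rewrite -sum_nat_const.
apply: leq_trans (leq_card_bigcup (Q := mem D)
  (F := fun S : {set T} =>
     [set r : {ffun 'I_p -> T} in ffun_on (mem S) | injectiveb r]) _).
  apply/subset_leq_card/fintype.subsetP=> r; rewrite inE => /andP[injr rD].
  apply/bigcupP; exists (r @: [set: 'I_p]) => //; rewrite inE injr andbT.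
  by apply/ffun_onP=> i; apply: imset_f.
by move=> S SD; rewrite card_inj_ffuns_on card_ord (cD S SD) ffactnn.
Qed.

(** The vertices are numbered by an arbitrary bijection with the words of
    length [m]. A matrix lists vertices by its rows, so that each vertex set
    comes from at most as many matrices as it has enumerations. *)
Lemma rainbow_count (k m : nat) :
  exists t : tournament k.+1 'I_(k.+2 ^ m),
    #|[set qs : m.-tuple {ffun 'I_k.+2 -> 'I_k.+2} | first_bijective qs]|
      <= #|directed_simplices t| * k.+2`!.
Proof.
have card_pts : #|{: m.-tuple 'I_k.+2}| = k.+2 ^ m.
  by rewrite card_tuple card_ord.
pose point (x : m.-tuple 'I_k.+2) := cast_ord card_pts (enum_rank x).
pose coord (l : 'I_m) (i : 'I_(k.+2 ^ m)) :=
  tnth (enum_val (cast_ord (esym card_pts) i)) l.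
have coordK x l : coord l (point x) = tnth x l.
  by rewrite /coord /point cast_ordK enum_rankK.
pose cs := [seq coord l | l <- enum 'I_m].
pose rows (qs : m.-tuple {ffun 'I_k.+2 -> 'I_k.+2}) :=
  [ffun i => point [tuple tnth qs l i | l < m]].
have colsK qs :
    [seq [ffun i => c (rows qs i)] | c : 'I_(k.+2 ^ m) -> 'I_k.+2 <- cs] = qs.
  rewrite -map_comp -[RHS]map_tnth_enum; apply: eq_map => l /=.
  by apply/ffunP=> i; rewrite !ffunE coordK tnth_mktuple.
have rows_inj : injective rows.
  by move=> qs qs' eq_rows; apply: val_inj; rewrite /= -colsK eq_rows colsK.
exists (exist _ (rainbow cs) (rainbow_tournament cs)).
clearbody rows; rewrite -(card_imset _ rows_inj).
apply: leq_trans (card_inj_ffuns_image _); last first.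
  by move=> S; rewrite inE => /andP[/eqP].
apply/subset_leq_card/fintype.subsetP=> _ /imsetP[qs + ->].
rewrite !inE => bij_qs.
have injr : injective (rows qs).
  move=> i j eq_ij; apply: (first_bijective_distinct bij_qs) => q.
  by rewrite -{1}(colsK qs) => /mapP[c _ ->]; rewrite !ffunE eq_ij.
have cS : #|rows qs @: [set: 'I_k.+2]| = k.+2.
  by rewrite card_imset // cardsT card_ord.
rewrite cS eqxx; apply/andP; split; first exact/injectiveP.
apply: first_rainbow_directed => //.
by apply: first_bijective_rainbow; rewrite ?colsK.
Qed.

(** * Averaging over vertex deletions *)

Lemma restrict_tournament (U T : finType) (k : nat) (chi : U -> T)
    (t : tournament k.+1 T) :
  injective chi ->
  exists u : tournament k.+1 U, forall S : {set U},
    chi @: S \in directed_simplices t -> S \in directed_simplices u.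
Proof.
move=> injc; have /is_tournamentP[ort fullt] := valP t.
pose f : family T k := val t.
pose g : family U k := [ffun A : {set U} => omap (pull chi A) (f (chi @: A))].
have tourg : is_tournament (d := k.+1) g.
  apply/is_tournamentP; split=> A; rewrite ffunE.
    case E: (f _) => [p|] //= o [<-].
    apply: is_orientation_pull; first exact: in2W.
    exact: ort.
  move=> cA; have := fullt (chi @: A); rewrite card_imset // => /(_ cA).
  by rewrite -/f; case: (f _).
exists (exist _ g tourg) => S; rewrite !inE card_imset // => /andP[-> /=].
apply: pull_pairwise_compatible => [|B o|A _].
- exact: in2W.
- exact: ort.
- by rewrite ffunE.
Qed.

(** Each of the n + 1 deletions of a vertex leaves at most [max_directed]
    directed simplices, and a directed simplex, having k + 2 vertices, survives
    the deletion of the n - (k + 1) others. *)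
Lemma max_directed_averaging (k n : nat) :
  max_directed k.+1 n.+1 * (n - k.+1) <= n.+1 * max_directed k.+1 n.
Proof.
have [->|nk_gt0] := posnP (n - k.+1); first by rewrite muln0.
rewrite -leq_divRL //; apply/bigmax_leqP=> t _; rewrite leq_divRL //.
set D := directed_simplices t.
have miss i : #|[set S in D | i \notin S]| <= max_directed k.+1 n.
  have [u uP] := restrict_tournament t (@lift_inj n.+1 i).
  apply: leq_trans (leq_bigmax u).
  apply: leq_trans (leq_imset_card (fun S : {set 'I_n} => lift i @: S) _).
  apply/subset_leq_card/fintype.subsetP=> S; rewrite inE => /andP[SD niS].
  suff defS : lift i @: (lift i @^-1: S) = S.
    by apply/imsetP; exists (lift i @^-1: S); rewrite // uP ?defS.
  apply/setP=> x; apply/imsetP/idP => [[y] | xS]; first by rewrite inE => yS ->.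
  have /unlift_some[y def_x _] : i != x by apply: contraNneq niS => ->.
  by exists y; rewrite // inE -def_x.
have -> : #|D| * (n - k.+1) = \sum_(i < n.+1) #|[set S in D | i \notin S]|.
  under eq_bigr => i _ do rewrite -sum1dep_card.
  rewrite (exchange_big_dep (mem D)) /=; last by move=> ? ? _ /andP[].
  rewrite -sum_nat_const; apply: eq_bigr => S SD.
  have cS : #|S| = k.+2 by move: SD; rewrite inE => /andP[/eqP].
  rewrite (eq_bigl (fun i => i \in ~: S)); last first.
    by move=> i; rewrite [RHS]inE SD.
  by rewrite sum1_card cardsCs finset.setCK card_ord cS subSS.
apply: leq_trans (leq_sum _ (fun i _ => miss i)) _.
by rewrite sum_nat_const card_ord.
Qed.

(** * The density of directed simplices *)

Lemma tournament_count (k m : nat) :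
  let N := #|{: {ffun 'I_k.+2 -> 'I_k.+2}}| in
  let c := #|[set q | @near_rainbow k q]| in
  'C(k.+2 ^ m, k.+2) * k.+2`! <= (k.+2 ^ m) ^ k.+2 /\
  N ^ m = (k.+2 ^ m) ^ k.+2 /\
  N ^ m <= (1 + 'C(k.+2, 2)) * (max_directed k.+1 (k.+2 ^ m) * k.+2`!)
           + (N - c) ^ m.
Proof.
move=> N c; split; last split.
- rewrite bin_ffact ffact_prod.
  apply: (@leq_trans (\prod_(i < k.+2) k.+2 ^ m)); last first.
    by rewrite prod_nat_const card_ord.
  by apply: leq_prod => i _; apply: leq_subr.
- by rewrite /N card_ffun !card_ord -!expnM mulnC.
have [t le_t] := rainbow_count k m.
rewrite -(leq_pmul2l (fact_gt0 k.+2)) mulnDr.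
rewrite -(count_first_bijective k m) leq_add2r.
have le_max : #|directed_simplices t| * k.+2`! <=
              max_directed k.+1 (k.+2 ^ m) * k.+2`!.
  by rewrite leq_pmul2r ?fact_gt0 //; apply: (leq_bigmax t).
apply: leq_trans (leq_mul (card_near_rainbow k) (leq_trans le_t le_max)) _.
by rewrite (mulnC (1 + _)) -mulnA.
Qed.

Lemma near_rainbow_gt0 (k : nat) : 0 < #|[set q | @near_rainbow k q]|.
Proof.
apply/card_gt0P; exists [ffun i => i]; rewrite inE.
by apply/existsP; exists ord0; apply/dinjectiveP=> x y _ _; rewrite !ffunE.
Qed.

Local Open Scope classical_set_scope.
Local Open Scope ring_scope.

Lemma directed_ratio_nonincreasing (R : realType) (k m n : nat) :
  (k.+2 <= m)%N -> (m <= n)%N ->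
  directed_ratio R k.+1 n <= directed_ratio R k.+1 m.
Proof.
move=> lem /subnK <-; elim: (n - m)%N => [//|j]; apply: le_trans.
rewrite addSn; move: (j + m)%N (leq_trans lem (leq_addl j m)) => {}n len.
rewrite /directed_ratio ler_pdivrMr ?ltr0n ?bin_gt0 ?(leq_trans len) //.
rewrite mulrAC ler_pdivlMr ?ltr0n ?bin_gt0 // -!natrM ler_nat.
have nk_gt0 : (0 < n - k.+1)%N by rewrite subn_gt0.
rewrite -(leq_pmul2r nk_gt0) mulnAC.
apply: leq_trans (leq_mul (max_directed_averaging k n) (leqnn _)) _.
have -> : (max_directed k.+1 n * 'C(n.+1, k.+2) * (n - k.+1) =
           max_directed k.+1 n * (n.+1 * 'C(n, k.+2)))%N.
  rewrite -mulnA; congr (_ * _)%N.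
  by rewrite [RHS](mul_bin_down n.+1 k.+2) subSS mulnC.
by rewrite mulnCA mulnA.
Qed.

(** The ratio at [n] is at least the ratio at every larger power of k + 2, and
    along these powers the proportion [rho ^+ m] of undecided matrices tends
    to 0. *)
Lemma directed_ratio_ge (R : realType) (k n : nat) :
  (k.+2 <= n)%N -> (1 + 'C(k.+2, 2)%:R)^-1 <= directed_ratio R k.+1 n.
Proof.
move=> len.
pose N := #|{: {ffun 'I_k.+2 -> 'I_k.+2}}|.
pose c := #|[set q | @near_rainbow k q]%SET|.
have c_gt0 : (0 < c)%N := near_rainbow_gt0 k.
have leN : (c <= N)%N.
  by rewrite /N -cardsT; apply/subset_leq_card/finset.subsetT.
have N_gt0 : 0 < N%:R :> R by rewrite ltr0n (leq_trans c_gt0).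
pose rho : R := (N - c)%:R / N%:R.
have rho_ge0 : 0 <= rho by rewrite divr_ge0.
have rho_lt1 : rho < 1.
  by rewrite ltr_pdivrMr // mul1r ltr_nat ltn_subrL c_gt0 -(ltr0n R).
have K_gt0 : 0 < 1 + 'C(k.+2, 2)%:R :> R by rewrite ltr_wpDr.
have geo m : (n <= m)%N ->
    1 - rho ^+ m <= (1 + 'C(k.+2, 2)%:R) * directed_ratio R k.+1 n.
  move=> lenm; have lenp : (n <= k.+2 ^ m)%N.
    by apply: leq_trans lenm _; apply/ltnW/ltn_expl.
  have lek := leq_trans len lenp.
  apply: (@le_trans _ _ ((1 + 'C(k.+2, 2)%:R) *
                         directed_ratio R k.+1 (k.+2 ^ m))); last first.
    rewrite ler_pM2l //.
    exact: directed_ratio_nonincreasing.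
  have [leC [eqN leM]] := tournament_count k m; rewrite -/N -/c in eqN leM.
  rewrite /directed_ratio mulrA ler_pdivlMr ?ltr0n ?bin_gt0 //.
  have F_gt0 : 0 < (k.+2`!)%:R :> R by rewrite ltr0n fact_gt0.
  rewrite -(ler_pM2r F_gt0) -mulrA -natrM.
  apply: (@le_trans _ _ ((1 - rho ^+ m) * (N ^ m)%:R)).
    apply: ler_wpM2l; last by rewrite ler_nat eqN.
    by rewrite subr_ge0 exprn_ile1 // ltW.
  rewrite mulrBl mul1r expr_div_n natrX divfK ?expf_neq0 ?gt_eqF // lerBlDr.
  by rewrite -!natrX -[1]/(1%:R) -natrD -!natrM -natrD ler_nat -mulnA.
rewrite -div1r ler_pdivrMr // mulrC.
have cvg1 : (fun m => 1 - rho ^+ m) @ \oo --> (1 : R).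
  rewrite -[X in _ --> X]subr0; apply: cvgB; first exact: cvg_cst.
  by apply: cvg_expr; rewrite ger0_norm.
suff : limn (fun m => 1 - rho ^+ m) <=
       (1 + 'C(k.+2, 2)%:R) * directed_ratio R k.+1 n.
  by rewrite (cvg_lim _ cvg1).
apply: limr_le; first by apply/cvg_ex; exists 1.
by near=> m; apply: geo; near: m; exists n.
Unshelve. all: by end_near. Qed.

Lemma cvg_directed_ratio (R : realType) (k : nat) :
  cvgn (fun n : nat => directed_ratio R k.+1 n).
Proof.
apply: (near_nonincreasing_is_cvgn (m := 0)); last first.
  by apply: nearW => n; rewrite /directed_ratio divr_ge0.
near=> m => n le_mn; apply: directed_ratio_nonincreasing le_mn.
by near: m; exists k.+2.
Unshelve. all: by end_near. Qed.

Theorem theorem3p3 (R : realType) (d : nat) (hd : (2 <= d)%N) :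
  (exists e : nat -> R,
      e =o_\oo (fun m : nat => ((d.+1 ^ m)%N%:R : R) ^+ d.+1) /\
      \forall m \near \oo,
        exists t : tournament d 'I_(d.+1 ^ m),
          (1 + 'C(d.+1, 2)%:R)^-1 * 'C(d.+1 ^ m, d.+1)%:R - e m
            <= #|directed_simplices t|%:R :> R)
  /\ (cvgn (fun n : nat => directed_ratio R d n)
      /\ (1 + 'C(d.+1, 2)%:R)^-1 <= c_ R d).
Proof.
case: d hd => [//|k] _; split; last split.
- (* The bound on [directed_ratio] holds without error, so an optimal
     tournament satisfies it with e = 0. *)
  exists (fun=> 0); split.
    apply/eqoP=> eps /ltW eps_ge0; apply: nearW => m.
    by rewrite normr0 mulr_ge0.
  near=> m; set n := (k.+2 ^ m)%N.
  have [|t maxt] := @bigop.eq_bigmax (tournament k.+1 'I_n)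
    (fun t => #|directed_simplices t|).
    (* There is at least one tournament, so the maximum is attained. *)
    apply/card_gt0P.
    by exists (exist _ (rainbow [::]) (rainbow_tournament [::])).
  exists t; rewrite subr0 -maxt -/(max_directed k.+1 n) -ler_pdivlMr.
    apply: directed_ratio_ge; apply: leq_trans (ltn_expl m _) => //.
    by near: m; exists k.+1.
  rewrite ltr0n bin_gt0; apply: leq_trans (ltn_expl m _) => //.
  by near: m; exists k.+1.
- exact: cvg_directed_ratio.
apply: limr_ge; first exact: cvg_directed_ratio.
by near=> n; apply: directed_ratio_ge; near: n; exists k.+2.
Unshelve. all: by end_near. Qed.
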